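(* For all positive integers $d$ and $\ell\ge 2$ there exists a constant $c := c(d,\ell)$ such that, for every integer $\Delta\ge d$ and every integer $n\ge \Delta$, every $n$-vertex $d$-degenerate graph $G$ of maximum degree at most $\Delta$ satisfies \[ \chi_{\ell\text{-vr}}(G)\le c\,\Delta^{\lfloor\ell/2\rfloor-1/2}\log^{5/4} n =\begin{cases} c\,\Delta^{\ell/2-1}\log^{5/4} n & \text{if } \ell \text{ is odd},\\ c\,\Delta^{\ell/2-1/2}\log^{5/4} n & \text{if } \ell \text{ is even}. \end{cases} \] Furthermore, if $\Delta^{\lfloor\ell/2\rfloor-1}\ge\log n$, then $\chi_{\ell\text{-vr}}(G)\le c\,\Delta^{\lfloor\ell/2\rfloor-1/2}\log n$.
   Context: Graphs are finite, simple and undirected. A graph $G$ is $d$-degenerate if every non-empty (induced) subgraph of $G$ has a vertex of degree at most $d$ in that subgraph. For a positive integer $\ell$, an $\ell$-vertex-ranking of a graph $G$ is a colouring $\varphi$ of the vertices of $G$ with integer colours such that in every connected subgraph $H$ of $G$ with diameter at most $\ell$, there is a vertex of $H$ whose colour is larger than that of every other vertex of $H$. The $\ell$-vertex-ranking number $\chi_{\ell\text{-vr}}(G)$ is the minimum integer $k$ such that $G$ has an $\ell$-vertex-ranking $\varphi:V(G)\to\{1,\ldots,k\}$. Here $\log^{5/4} n$ means $(\log n)^{5/4}$.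
   Formalization: The formal statement assumes n ≥ 2: for d = Δ = n = 1 and G = K_1 the right-hand sides are 0 since log 1 = 0, while the ranking number is 1, so the literal claim fails; only this case is excluded. *)

(* Defs.v *)
From HB Require Import structures.
From mathcomp Require Import all_boot all_order all_algebra.
From mathcomp Require Import boolp reals.

Set Implicit Arguments.
Unset Strict Implicit.
Unset Printing Implicit Defensive.
Import Order.TTheory GRing.Theory Num.Theory.

Record sgraph (T : finType) := SGraph {
  adj :> rel T;
  adj_sym : symmetric adj;
  adj_irr : irreflexive adj }.

Definition degree (T : finType) (G : sgraph T) (x : T) : nat :=
  #|[set y | G x y]|.

Definition max_degree (T : finType) (G : sgraph T) : nat :=
  \max_(x : T) degree G x.

Definition degenerate (T : finType) (d : nat) (G : sgraph T) : Prop :=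
  forall S : {set T}, S != set0 ->
    exists2 x, x \in S & #|[set y in S | G x y]| <= d.

(* Subgraphs need not be induced. *)
Record subgraph (T : finType) (G : sgraph T) := Subgraph {
  sverts : {set T};
  sadj : rel T;
  sadj_sym : symmetric sadj;
  sadj_sub : forall x y, sadj x y -> [&& x \in sverts, y \in sverts & G x y] }.

Definition connected (T : finType) (G : sgraph T) (H : subgraph G) : Prop :=
  sverts H != set0 /\
  {in sverts H &, forall x y, connect (sadj H) x y}.

(* The least length of a walk from x to y in H; it is at most #|T|.-1 when
   such a walk exists, and the value is #|T| by convention otherwise. *)
Definition dist (T : finType) (G : sgraph T) (H : subgraph G) (x y : T) : nat :=
  find (fun k => [exists p : k.-tuple T, path (sadj H) x p && (last x p == y)])
       (iota 0 #|T|).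

Definition diameter (T : finType) (G : sgraph T) (H : subgraph G) : nat :=
  \max_(x in sverts H) \max_(y in sverts H) dist H x y.

Definition vertex_ranking (T : finType) (l : nat) (G : sgraph T)
    (phi : T -> int) : Prop :=
  forall H : subgraph G, connected H -> diameter H <= l ->
    exists2 x, x \in sverts H &
      {in sverts H, forall y, y != x -> (phi y < phi x)%R}.

Definition has_vertex_ranking (T : finType) (l : nat) (G : sgraph T)
    (k : nat) : Prop :=
  exists2 phi : T -> int, vertex_ranking l G phi &
    forall x, (1 <= phi x <= Posz k)%R.

Lemma has_vertex_ranking_ex (T : finType) (l : nat) (G : sgraph T) :
  exists k, `[< has_vertex_ranking l G k >].
Proof.
exists #|T|; apply/asboolP.
exists (fun x => Posz (enum_rank x).+1) => [H [/set0Pn[x0 x0H] _] _|x]; last first.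
  by rewrite !lez_nat /= ltn_ord.
case: (arg_maxnP (fun x => enum_rank x : nat) x0H) => x xH xmax.
exists x => // y yH yx; rewrite ltz_nat ltnS ltn_neqAle; apply/andP; split.
  by apply: contra yx => /eqP /val_inj /enum_rank_inj ->.
exact: xmax.
Qed.

Definition vr_number (T : finType) (l : nat) (G : sgraph T) : nat :=
  ex_minn (has_vertex_ranking_ex l G).

(* Main.v *)
Require Import Defs.
From mathcomp Require Import all_boot all_order all_algebra.
From mathcomp Require Import boolp reals sequences exp.
From mathcomp Require Import zify ring lra.

(** Write r = floor(l/2). It suffices that, on every walk of length at most l
    between two distinct vertices of equal colour, some vertex has a larger
    colour. Degeneracy gives O(log n) layers such that every vertex has at most
    4d neighbours on its own layer or above, so only O(Delta^a) vertices are
    reached by walks of length at most l with at most a downward steps; and a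
    walk of length at most l has at most r downward steps in one of its two
    directions.

    Each layer gets its own palette of k ~ Delta^(r-1/2) colours, palettes of
    higher layers being larger. A monochromatic bad walk from s to e then either
    is level, which happens for O(1) pairs per vertex and is avoided, or has a
    first vertex w on a lower layer, from which at most r-1 downward steps
    remain; then w is promoted to a set B that is coloured on top of all
    palettes. The vertices are coloured one at a time, in an order (by
    averaging) in which each has O(Delta^r) conflicts (s, w, e) with earlier
    ones, so that at least half of the colours promote at most O(sqrt Delta)
    vertices at once. A colour minimising an exponential potential keeps the
    number of vertices of B reached with at most r downward steps from any
    vertex below O(Delta^(r-1/2) log n). The graph of these incidences on B has
    bounded out-degree, hence B needs only O(Delta^(r-1/2) log n) colours. This
    gives c Delta^(r-1/2) log n for every Delta, from which both bounds follow. *)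

Set Implicit Arguments.
Unset Strict Implicit.
Unset Printing Implicit Defensive.
Import Order.TTheory GRing.Theory Num.Theory.

(** * Greedy colourings and layers *)

(** Averaging: over [S], row sums and column sums of [f] have the same total, at most [M * #|S|],
    although a single column may be heavy. *)
Lemma exists_low_weight (T : finType) (f : T -> T -> nat) (M : nat) (S : {set T}) :
  S != set0 -> (forall x, x \in S -> \sum_(y in S) f x y <= M) ->
  exists2 x, x \in S & \sum_(y in S) (f x y + f y x) <= 2 * M.
Proof.
move=> S0 fM; apply/exists_inP; apply: contraT => /exists_inPn low.
have cS : 0 < #|S| by rewrite card_gt0.
suff : \sum_(x in S) \sum_(y in S) (f x y + f y x) <= #|S| * (2 * M).
  have : #|S| * (2 * M).+1 <= \sum_(x in S) \sum_(y in S) (f x y + f y x).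
    rewrite -sum_nat_const; apply: leq_sum => x /low.
    by rewrite -ltnNge.
  by lia.
under eq_bigr do rewrite big_split.
rewrite big_split /= [X in _ + X <= _]exchange_big /= addnn -mul2n mulnCA.
by rewrite leq_mul2l -sum_nat_const leq_sum.
Qed.

(** [e] is not assumed symmetric. Bounded out-degree passes to subsets, so each non-empty subset has
    a vertex with in-degree plus out-degree at most [2 * X]; it is removed and coloured greedily
    last. *)
Lemma exists_proper_coloring (T : finType) (e : rel T) (X : nat) (S : {set T}) :
  (forall x, x \in S -> #|[set y in S | e x y]| <= X) ->
  exists2 c : T -> nat, forall x, c x < (2 * X).+1 &
    {in S &, forall x y, x != y -> e x y -> c x != c y}.
Proof.
move: {2}#|S| (erefl #|S|) => n; elim: n S => [|n IH] S cS hX.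
  exists (fun=> 0) => // x y; move/eqP: cS; rewrite cards_eq0 => /eqP ->.
  by rewrite inE.
have S0 : S != set0 by rewrite -card_gt0 cS.
have [x xS xlow] : exists2 x, x \in S & \sum_(y in S) (e x y + e y x) <= 2 * X.
  apply: (exists_low_weight (f := fun x y => e x y : nat)) => // x xS.
  rewrite -big_mkcondr/= sum1_card; apply: leq_trans (hX x xS).
  by rewrite cardsE subset_leq_card //; apply/subsetP=> y; rewrite !inE.
have cS' : #|S :\ x| = n by move: cS; rewrite (cardsD1 x) xS; case.
have [|c ck cP] := IH (S :\ x) cS'.
  move=> y; rewrite inE => /andP[_ yS]; apply: leq_trans (hX y yS).
  by apply/subset_leq_card/subsetP => z; rewrite !inE -andbA => /and3P[_ -> ->].
pose N := [set y in S :\ x | e x y || e y x].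
have cN : #|N| <= 2 * X.
  apply: leq_trans xlow; rewrite [X in _ <= X](big_setD1 x)//=.
  apply: leq_trans (leq_addl _ _).
  rewrite -sum1_card /N big_mkcond [X in _ <= X]big_mkcond /=.
  by apply: leq_sum => y _; rewrite !inE; case: (_ && _) (e x y) (e y x) => [] [] [].
have [a aN] : exists a : 'I_(2 * X).+1, a \notin [set inord (c y) | y in N].
  apply/existsP; rewrite -negb_forall; apply/negP => /forallP aN.
  have : #|'I_(2 * X).+1| <= #|[set (inord (c y) : 'I_(2 * X).+1) | y in N]|.
    by apply/subset_leq_card/subsetP => a _; exact: aN.
  rewrite card_ord => /leq_trans /(_ (leq_imset_card _ _)).
  by rewrite ltnNge cN.
have ay y : y \in N -> val a != c y.
  move=> yN; apply: contraNneq aN => aE; apply/imsetP; exists y => //.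
  by apply/val_inj; rewrite /= inordK ?ck.
exists (fun y => if y == x then val a else c y) => [y|y z yS zS].
  by case: ifP => _; rewrite ?ck ?ltn_ord.
case: (eqVneq y x) (eqVneq z x) => [->|yx] [->|zx] yz eyz; rewrite ?eqxx// in yz *.
- by rewrite ay// !inE zx zS eyz.
- by rewrite eq_sym ay// !inE yx yS eyz orbT.
- by apply: cP => //; rewrite !inE ?yx ?zx.
Qed.

Section Layers.
Variables (T : finType) (d : nat) (G : sgraph T).
Hypothesis degG : degenerate d G.

(** Deleting a vertex of degree at most [d] removes at most [2 * d] ordered adjacent pairs. *)
Lemma degenerate_sum (S : {set T}) : \sum_(x in S) #|[set y in S | G x y]| <= 2 * d * #|S|.
Proof.
move: {2}#|S| (erefl #|S|) => n; elim: n S => [|n IH] S cS.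
  by move/eqP: (cS); rewrite cards_eq0 => /eqP ->; rewrite big_set0.
have [|x xS xd] := @degG S; first by rewrite -card_gt0 cS.
have cS' : #|S :\ x| = n by move: cS; rewrite (cardsD1 x) xS; case.
have -> : #|S| = #|S :\ x|.+1 by rewrite cS cS'.
have IHx := IH _ cS'.
rewrite (big_setD1 x)//=.
have -> : \sum_(y in S :\ x) #|[set z in S | G y z]| =
    \sum_(y in S :\ x) G y x + \sum_(y in S :\ x) #|[set z in S :\ x | G y z]|.
  rewrite -big_split; apply: eq_bigr => y _ /=.
  rewrite (cardsD1 x) !inE xS /=; congr (_ + _).
  by apply: eq_card => z; rewrite !inE andbA.
have : \sum_(y in S :\ x) G y x <= d.
  apply: leq_trans xd; rewrite -sum1_card -big_mkcondr/= big_mkcond [leqRHS]big_mkcond/=.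
  by apply: leq_sum => y _; rewrite !inE adj_sym; case: (y \in S) (y == x) (G x y) => [] [] [].
move: xd IHx; rewrite mulnS; lia.
Qed.

Lemma exists_layering_in (j : nat) (S : {set T}) : #|S| < 2 ^ j ->
  exists2 lay : T -> nat, {in S, forall x, lay x < j} &
    {in S, forall x, #|[set y in S | G x y & lay x <= lay y]| <= 4 * d}.
Proof.
elim: j S => [|j IH] S cS.
  have /eqP : #|S| = 0 by case: #|S| cS.
  by rewrite cards_eq0 => /eqP ->; exists (fun=> 0) => x; rewrite inE.
(* The vertices of large degree, at most half of [S] by the degree sum, move one layer up and are
   layered recursively; the others form layer 0. *)
pose H := [set x in S | 4 * d < #|[set y in S | G x y]|].
have HS : H \subset S by apply/subsetP => x; rewrite inE => /andP[].
have cH : 2 * #|H| <= #|S|.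
  have := degenerate_sum S.
  have : (4 * d).+1 * #|H| <= \sum_(x in S) #|[set y in S | G x y]|.
    rewrite (big_setID H)/= (setIidPr HS); apply: leq_trans (leq_addr _ _).
    rewrite mulnC -sum_nat_const; apply: leq_sum => x.
    by rewrite inE => /andP[].
  by nia.
have [|lay layj layH] := IH H; first by move: cS; rewrite expnS; lia.
exists (fun x => if x \in H then (lay x).+1 else 0) => x xS.
  by case: ifP => // /layj.
case: ifPn => xH.
  apply: leq_trans (layH x xH); apply/subset_leq_card/subsetP => y.
  by rewrite inE => /and3P[yS xy]; case: ifP => // yH le_xy; rewrite inE yH xy.
move: xH; rewrite inE xS /= -leqNgt; apply: leq_trans.
by apply/subset_leq_card/subsetP => y; rewrite !inE => /and3P[-> ->].
Qed.

Lemma exists_layering (j : nat) : #|T| < 2 ^ j ->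
  exists2 lay : T -> nat, forall x, lay x < j &
    forall x, #|[set y | G x y & lay x <= lay y]| <= 4 * d.
Proof.
rewrite -cardsT => /exists_layering_in[lay layj layd]; exists lay => x.
  exact: layj.
apply: leq_trans (layd x _) => //; apply/subset_leq_card/subsetP => y.
by rewrite !inE.
Qed.

End Layers.

(** * Walks *)

(** Let [x] have maximum colour in [H]. A second vertex of that colour is joined to [x] by a walk of
    length at most [l] inside [H], on which no colour is larger. The successor shifts colours to
    start at 1. *)
Lemma vertex_ranking_walks (T : finType) (l : nat) (G : sgraph T) (phi : T -> nat) :
  (forall x p, path G x p -> size p <= l -> last x p != x ->
     phi (last x p) = phi x -> has (fun z => phi x < phi z) p) ->
  vertex_ranking l G (fun x => Posz (phi x).+1).
Proof.
move=> phiP H [/set0Pn[x0 x0H] Hconn] diamH.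
case: (arg_maxnP phi x0H) => x xH xmax; exists x => // y yH yx.
rewrite ltz_nat ltnS ltn_neqAle; apply/andP; split; last exact: xmax.
apply/eqP => phiyx.
have distxy : dist H x y <= l.
  apply: leq_trans diamH; rewrite /diameter.
  by rewrite (bigD1 x)//= (bigD1 y yH)/= -!maxnA leq_maxl.
pose good k := [exists p : k.-tuple T, path (sadj H) x p && (last x p == y)].
(* This excludes the default value of [dist]: a walk without repeated vertices has fewer than [#|T|]
   steps. *)
have hasgood : has good (iota 0 #|T|).
  have /connectP[q pathq ylast] := Hconn x y xH yH.
  case/shortenP: pathq ylast => p pathp uniqp _ ylast.
  apply/hasP; exists (size p).
    by rewrite mem_iota /= add0n; have := max_card (mem (x :: p)); rewrite (card_uniqP uniqp).
  by apply/existsP; exists (in_tuple p); rewrite pathp ylast eqxx.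
have := nth_find 0 hasgood; rewrite nth_iota ?add0n; last first.
  by rewrite -[X in _ < X](size_iota 0) -has_find.
move=> /existsP[p /andP[pathp /eqP lastp]].
have subH q b z : path (sadj H) b q -> z \in q -> z \in sverts H.
  elim: q b => //= a q IH b /andP[/sadj_sub /and3P[_ aH _] /IH{}IH].
  by rewrite inE => /orP[/eqP ->|/IH].
have pathG : path G x p by apply: sub_path pathp => a b /sadj_sub /and3P[].
have := phiP x p pathG; rewrite lastp size_tuple => /(_ distxy yx phiyx).
by move=> /hasP[z /(subH _ _ _ pathp) /xmax]; rewrite /= leqNgt => /negPf ->.
Qed.

Section Reach.
Variables (T : finType) (G : sgraph T) (lay : T -> nat).

(* The ends of the walks from [v] with at most [m] steps, at most [a] of which
   go to a strictly lower layer. *)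
Fixpoint reach (m a : nat) (v : T) : {set T} :=
  if m isn't m'.+1 then [set v] else
  v |: \bigcup_(y in [set y | G v y & lay v <= lay y]) reach m' a y
    :|: (if a isn't a'.+1 then set0 else
         \bigcup_(y in [set y | G v y & lay y < lay v]) reach m' a' y).

Lemma reach_refl (m a : nat) (v : T) : v \in reach m a v.
Proof. by case: m => [|m] /=; rewrite !inE eqxx. Qed.

Lemma reach_up (m a : nat) (v y z : T) :
  G v y -> lay v <= lay y -> z \in reach m a y -> z \in reach m.+1 a v.
Proof.
move=> vy le_vy zy; rewrite /= !inE; apply/orP; left; apply/orP; right.
by apply/bigcupP; exists y; rewrite // inE vy.
Qed.

Lemma reach_down (m a : nat) (v y z : T) :
  G v y -> lay y < lay v -> z \in reach m a y -> z \in reach m.+1 a.+1 v.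
Proof.
move=> vy lt_yv zy; rewrite /= !inE; apply/orP; right.
by apply/bigcupP; exists y; rewrite // inE vy.
Qed.

Variant reach_spec (m a : nat) (v z : T) : Prop :=
| ReachRefl of z = v
| ReachUp m' y of m = m'.+1 & G v y & lay v <= lay y & z \in reach m' a y
| ReachDown m' a' y of m = m'.+1 & a = a'.+1 & G v y & lay y < lay v
    & z \in reach m' a' y.

Lemma reachP (m a : nat) (v z : T) : z \in reach m a v -> reach_spec m a v z.
Proof.
case: m => [|m] /=; first by rewrite inE => /eqP/ReachRefl.
rewrite !inE -orbA => /or3P[/eqP/ReachRefl//|/bigcupP[y]|].
  by rewrite inE => /andP[]; exact: ReachUp.
case: a => [|a]; first by rewrite inE.
by move=> /bigcupP[y]; rewrite inE => /andP[]; exact: ReachDown.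
Qed.


Lemma reach_mono (m m' a a' : nat) (x z : T) :
  m <= m' -> a <= a' -> z \in reach m a x -> z \in reach m' a' x.
Proof.
elim: m' m a a' x => [|m' IH] m a a' x.
  by rewrite leqn0 => /eqP -> _; rewrite !inE.
move=> mm aa /reachP[->|n y mE xy le_xy zy|n b y mE aE xy lt_yx zy].
- exact: reach_refl.
- by apply: (reach_up xy le_xy); apply: IH zy; rewrite // -ltnS -mE.
- case: a' aa => [|a'] aa; first by rewrite aE in aa.
  apply: (reach_down xy lt_yx); apply: IH zy; first by rewrite -ltnS -mE.
  by rewrite -ltnS -aE.
Qed.

Lemma reach_trans (m m' a a' : nat) (x y z : T) :
  y \in reach m a x -> z \in reach m' a' y -> z \in reach (m + m') (a + a') x.
Proof.
move=> + zy; elim: m a x => [|m IH] a x.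
  rewrite inE => /eqP <-; apply: reach_mono zy; rewrite ?add0n//.
  exact: leq_addl.
move=> /reachP[yx|n v [<-] xv le_xv yv|n b v [<-] -> xv lt_vx yv].
- by rewrite -yx; apply: reach_mono zy; rewrite leq_addl.
- exact: reach_up xv le_xv (IH _ _ yv).
- exact: reach_down xv lt_vx (IH _ _ yv).
Qed.

(** The factor [D + 2] per step counts stopping at [v], the [D] level or upward steps, and one unit
    for all downward steps, whose [Delta] choices are paid for by lowering [a]. *)
Lemma card_reach (D Delta m a : nat) (v : T) : 0 < Delta ->
  (forall x, #|[set y | G x y & lay x <= lay y]| <= D) ->
  (forall x, degree G x <= Delta) ->
  #|reach m a v| <= (D + 2) ^ m * Delta ^ a.
Proof.
move=> Delta0 upD deg.
have bigcup_le (I : {set T}) (F : T -> {set T}) N M : #|I| <= N ->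
    (forall i, #|F i| <= M) -> #|\bigcup_(i in I) F i| <= N * M.
  move=> cI cF; apply: leq_trans (_ : \sum_(i in I) #|F i| <= _).
    elim/big_rec2: _ => [|i A B _ le_AB]; first by rewrite cards0.
    by apply: leq_trans (leq_card_setU _ _) _; rewrite leq_add2l.
  apply: leq_trans (_ : #|I| * M <= _); last by rewrite leq_mul2r cI orbT.
  by rewrite -sum_nat_const; apply: leq_sum => i _; exact: cF.
elim: m a v => [|m IH] a v; first by rewrite /= cards1 mul1n expn_gt0 Delta0.
have le1 : 1 <= (D + 2) ^ m * Delta ^ a by rewrite muln_gt0 !expn_gt0 Delta0 addn2.
have up : #|\bigcup_(y in [set y | G v y & lay v <= lay y]) reach m a y| <=
    D * ((D + 2) ^ m * Delta ^ a) by apply: bigcup_le.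
have down : #|(if a isn't a'.+1 then set0 else
    \bigcup_(y in [set y | G v y & lay y < lay v]) reach m a' y) : {set T}| <=
    (D + 2) ^ m * Delta ^ a.
  case: a {up le1} => [|a]; first by rewrite cards0.
  rewrite expnS mulnCA; apply: bigcup_le => //.
  apply: leq_trans (deg v); apply/subset_leq_card/subsetP => y.
  by rewrite !inE => /andP[].
rewrite /=; apply: leq_trans (leq_card_setU _ _) _.
have [+ _] := leq_card_setU [set v]
  (\bigcup_(y in [set y | G v y & lay v <= lay y]) reach m a y).
rewrite cards1 expnS -mulnA mulnDl mul2n -addnn addnA => /leq_trans cup.
by apply: leq_add down; apply: cup; rewrite addnC leq_add.
Qed.

Definition downs (x : T) (p : seq T) : nat :=
  sumn (pairmap (fun y z => lay z < lay y : nat) x p).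

Lemma downs_cons (x z : T) (p : seq T) :
  downs x (z :: p) = (lay z < lay x) + downs z p.
Proof. by []. Qed.

Lemma downs_rcons (x z : T) (p : seq T) :
  downs x (rcons p z) = downs x p + (lay z < lay (last x p)).
Proof. elim: p x => [|y p IH] x /=; first by rewrite /downs /= addn0.
by rewrite !downs_cons IH addnA. Qed.

Lemma reach_path (x : T) (p : seq T) :
  path G x p -> last x p \in reach (size p) (downs x p) x.
Proof.
elim: p x => [|y p IH] x; first by rewrite reach_refl.
move=> /= /andP[xy /IH{}IH]; rewrite downs_cons; case: ltnP => xy'.
  exact: reach_down xy xy' IH.
exact: reach_up xy xy' IH.
Qed.

(** An edge goes down in at most one of its two directions, so the descents of a walk and of its
    reversal add up to at most its length. *)
Lemma reverse_path (x : T) (p : seq T) : path G x p ->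
  exists q, [/\ path G (last x p) q, last (last x p) q = x, size q = size p,
    {subset q <= x :: p} & downs x p + downs (last x p) q <= size p].
Proof.
elim: p x => [|y p IH] x /=; first by exists [::]; split => //.
move=> /andP[xy /IH[q [pathq lastq sizeq subq downq]]].
exists (rcons q x); split.
- by rewrite rcons_path pathq lastq adj_sym.
- by rewrite last_rcons.
- by rewrite size_rcons sizeq.
- move=> z; rewrite mem_rcons !inE => /orP[->//|/subq].
  by rewrite inE => ->; rewrite orbT.
- rewrite downs_rcons lastq /downs /= -/(downs y p) -/(downs (last y p) q).
  by case: ltngtP; lia.
Qed.

(* [w] is the first vertex of the walk on a lower layer: the walk is level
   before it, and one descent has been used up. *)
Lemma first_descent (x : T) (p : seq T) (m a : nat) :
  path G x p -> size p <= m -> downs x p <= a ->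
  {in p, forall z, lay z <= lay x} ->
  (last x p \in reach m 0 x /\ x \in reach m 0 (last x p)) \/
  exists2 w, w \in p & [/\ w \in reach m 1 x, x \in reach m 0 w
                         & last x p \in reach m a.-1 w].
Proof.
elim: p x m => [|z p IH] x m; first by left; rewrite !reach_refl.
case: m => // m pathxp; rewrite ltnS => sizep.
have /andP[xz pathp] := pathxp; rewrite downs_cons => downp le_x.
have := le_x z (mem_head _ _); rewrite leq_eqVlt => /orP[/eqP zxE|lt_zx].
  have [||[r1 r2]|[w wp [r1 r2 r3]]] := IH z m pathp sizep.
  - by move: downp; rewrite zxE ltnn.
  - by move=> y yp; rewrite zxE le_x// inE yp orbT.
  - left; split; first by apply: (reach_up xz) r1; rewrite zxE.
    rewrite -addn1 -[0]/(0 + 0); apply: reach_trans r2 _.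
    by apply: (@reach_up 0 0 z x); rewrite ?reach_refl ?zxE// adj_sym.
  - right; exists w; first by rewrite inE wp orbT.
    split; first by apply: (reach_up xz) r1; rewrite zxE.
      rewrite -addn1 -[0]/(0 + 0); apply: reach_trans r2 _.
      by apply: (@reach_up 0 0 z x); rewrite ?reach_refl ?zxE// adj_sym.
    exact: reach_mono r3.
right; exists z; first exact: mem_head.
split.
- exact: reach_down xz lt_zx (reach_refl _ _ _).
- by apply: (@reach_up m 0 z x); rewrite ?reach_refl// 1?adj_sym// ltnW.
- apply: reach_mono (reach_path pathp); first exact: leqW.
  by move: downp; rewrite lt_zx; lia.
Qed.

End Reach.

(** * Colouring with promotion *)

(** Inverting [1 - x <= expR (- x)] gives [expR x <= 1 / (1 - x)], which is at most [1 + 2 * x] on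
    this range. *)
Lemma expR_le1D2x (R : realType) (x : R) : (0 <= x -> x <= 1 / 2 -> expR x <= 1 + 2 * x)%R.
Proof.
move=> x0 x2; have := expR_ge1Dx (- x); rewrite expRN => le_inv.
have lt0 : (0 < expR x)%R by exact: expR_gt0.
have : ((1 - x) * expR x <= 1)%R by rewrite -ler_pdivlMr// div1r.
nra.
Qed.

Lemma exists_le_average (R : realType) (A : finType) (P : {set A}) (h : A -> R) (m : R) :
  P != set0 -> (\sum_(a in P) h a <= m *+ #|P| -> exists2 a, a \in P & h a <= m)%R.
Proof.
move=> P0 le_hm; apply/exists_inP; apply: contraT => /exists_inPn low.
have /set0Pn[a aP] := P0.
suff : (m *+ #|P| < \sum_(a in P) h a)%R by rewrite ltNge le_hm.
rewrite -sumr_const (bigD1 a)//= [ltRHS](bigD1 a)//=.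
apply: ltr_leD; first by rewrite ltNge low.
by apply: ler_sum => b /andP[bP _]; rewrite ltW// ltNge low.
Qed.

Section Promotion.
Variables (R : realType) (T I : finType) (K : T -> T -> T -> bool) (F : rel T).
Variables (W : I -> {set T}) (k t M C : nat).

Let g (V : {set T}) (s e : T) := #|[set w in V | K s w e]|.

(** The vertices that must enter the promoted set if [x] receives colour [a] while [S] is already
    coloured by [c]. *)
Let promoted (S : {set T}) (c : T -> 'I_k) (x : T) (a : 'I_k) :=
  [set w | [exists y in S, (c y == a) && (K x w y || K y w x)]].

(** A conflict between [x] and [y] promotes its middle vertex for the single colour [c y] only. *)
Let sum_promoted (V S : {set T}) (c : T -> 'I_k) (x : T) :
  \sum_a #|V :&: promoted S c x a| <= \sum_(y in S) (g V x y + g V y x).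
Proof.
rewrite (partition_big c xpredT)//=; apply: leq_sum => a _.
apply: leq_trans (_ : #|\bigcup_(y in S | c y == a)
    ([set w in V | K x w y] :|: [set w in V | K y w x])| <= _).
  apply/subset_leq_card/subsetP => w; rewrite !inE => /andP[wV].
  move=> /existsP[y /and3P[yS cy Kxy]]; apply/bigcupP; exists y; first by rewrite yS.
  by rewrite !inE wV.
elim/big_rec2: _ => [|y n A _ le_n]; first by rewrite cards0.
apply: leq_trans (leq_card_setU _ _) _; apply: leq_add le_n.
exact: leq_card_setU.
Qed.

Hypotheses (t_gt0 : 0 < t) (k_gt0 : 0 < k).
Hypothesis KM : forall s, \sum_e #|[set w | K s w e]| <= M.
Hypotheses (Fsym : symmetric F) (FC : forall x, #|[set y | F x y]| <= C).
Hypothesis k_large : 2 * C * t + 4 * M <= k * t.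

(** At most [2 * M / t] colours promote more than [t] vertices and at most [C] are forbidden by [F];
    by [k_large] these are together at most half of all colours. *)
Let many_colors (S : {set T}) (c : T -> 'I_k) (x : T) :
  \sum_(y in S) (#|[set w | K x w y]| + #|[set w | K y w x]|) <= 2 * M ->
  k <= 2 * #|[set a | (#|promoted S c x a| <= t) &&
    [forall y in S, F x y ==> (c y != a)]]|.
Proof.
move=> xlow; set A := [set a | _].
pose N1 := [set a | t < #|promoted S c x a|]; pose N2 := c @: [set y | F x y].
have cN1 : #|N1| * t <= 2 * M.
  apply: leq_trans xlow.
  apply: leq_trans (_ : \sum_a #|setT :&: promoted S c x a| <= _).
    rewrite -sum_nat_const big_mkcond; apply: leq_sum => a _.
    by rewrite setTI inE; case: ltnP => // /ltnW.
  apply: leq_trans (sum_promoted _ _ _ _) _; apply: leq_sum => y _.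
  by apply: leq_add; apply/subset_leq_card/subsetP => w; rewrite !inE.
have cN2 : #|N2| <= C by apply: leq_trans (FC x); exact: leq_imset_card.
have cA : k <= #|A| + (#|N1| + #|N2|).
  rewrite -[X in X <= _]card_ord -cardsT.
  apply: leq_trans (_ : #|A :|: (N1 :|: N2)| <= _); last first.
    apply: leq_trans (leq_card_setU _ _) _; rewrite leq_add2l.
    exact: leq_card_setU.
  apply/subset_leq_card/subsetP => a _; rewrite !inE leqNgt.
  case: ltnP => //= _; rewrite ?orbT//.
  case: (boolP (a \in N2)) => [|aN2]; first by rewrite !orbT.
  rewrite orbF; apply/forall_inP => y yS; apply/implyP => Fxy.
  by apply: contraNneq aN2 => <-; apply/imsetP; exists y; rewrite ?inE.
have : 2 * (#|N1| + #|N2|) * t <= k * t.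
  by apply: leq_trans k_large; nia.
rewrite leq_pmul2r//; lia.
Qed.

(* Pessimistic estimator: up to scaling, the subtracted term bounds the expected
   size of [W i :&: B] when each colour is drawn among at least [k / 2] ones. *)
Let potential (S B : {set T}) : R :=
  (\sum_i expR (#|W i :&: B|%:R / (2 * t)%:R -
     2 / (t * k)%:R * (\sum_(s in S) \sum_(e in S) g (W i) s e)%:R))%R.

Let potential_step (S B : {set T}) (c : T -> 'I_k) (x : T) (A : {set 'I_k}) :
  x \in S -> k <= 2 * #|A| -> {in A, forall a, #|promoted (S :\ x) c x a| <= t} ->
  (potential (S :\ x) B <= #|I|%:R)%R ->
  exists2 a, a \in A & (potential S (B :|: promoted (S :\ x) c x a) <= #|I|%:R)%R.
Proof.
move=> xS kA At pot.
have A_gt0 : 0 < #|A| by lia.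
apply: exists_le_average; first by rewrite -card_gt0.
apply: le_trans (_ : (potential (S :\ x) B *+ #|A| <= _)%R); last first.
  by rewrite lerMn2r pot orbT.
rewrite /potential exchange_big /= -sumrMnl; apply: ler_sum => i _.
set q := \sum_(s in S :\ x) \sum_(e in S :\ x) _.
set old := (X in (expR X *+ _)%R).
pose Y := \sum_(y in S :\ x) (g (W i) x y + g (W i) y x).
pose del a := #|W i :&: promoted (S :\ x) c x a|.
have qS : q + Y <= \sum_(s in S) \sum_(e in S) g (W i) s e.
  rewrite [leqRHS](big_setD1 x xS)/= addnC (big_setD1 x xS (F := g (W i) x))/=.
  rewrite -[leqRHS]addnA; apply: leq_trans (leq_addl _ _).
  rewrite /Y big_split/= -addnA leq_add2l /q -big_split; apply: leq_sum => s _.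
  by rewrite [leqRHS](big_setD1 x xS).
have delY : \sum_(a in A) del a <= Y.
  apply: leq_trans (sum_promoted (W i) (S :\ x) c x).
  by rewrite big_mkcond; apply: leq_sum => a _; case: ifP.
have t0 : (0 < t%:R :> R)%R by rewrite ltr0n.
have k0 : (0 < k%:R :> R)%R by rewrite ltr0n.
pose al : R := (2 / (t * k)%:R)%R.
have al0 : (0 <= al)%R by rewrite divr_ge0// ler0n.
(* Colouring [x] adds at most [del a / (2 * t)] to the exponent and subtracts at least [al * Y]. As
   [del a <= t], the exponential of the former is at most [1 + del a / t]. *)
have step a : a \in A ->
    (expR (#|W i :&: (B :|: promoted (S :\ x) c x a)|%:R / (2 * t)%:R
       - 2 / (t * k)%:R * (\sum_(s in S) \sum_(e in S) g (W i) s e)%:R)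
     <= expR old * expR (- (al * Y%:R)) * (1 + (del a)%:R / t%:R))%R.
  move=> aA.
  have dela : del a <= t by apply: leq_trans (At a aA); rewrite subset_leq_card// subsetIr.
  apply: le_trans (_ : (expR old * expR (- (al * Y%:R)) * expR ((del a)%:R / (2 * t)%:R) <= _)%R).
    rewrite -!expRD ler_expR /old -/al.
    have le1 : (#|W i :&: (B :|: promoted (S :\ x) c x a)|%:R / (2 * t)%:R <=
        (#|W i :&: B|%:R + (del a)%:R) / (2 * t)%:R :> R)%R.
      rewrite ler_pM2r ?invr_gt0 ?ltr0n ?muln_gt0// -natrD ler_nat setIUr.
      exact: leq_card_setU.
    have le2 : (al * (q%:R + Y%:R) <= al * (\sum_(s in S) \sum_(e in S) g (W i) s e)%:R)%R.
      by rewrite ler_wpM2l// -natrD ler_nat.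
    move: le1 le2; rewrite mulrDl mulrDr; lra.
  rewrite ler_wpM2l ?mulr_ge0 ?expR_ge0//.
  have -> : ((del a)%:R / t%:R = 2 * ((del a)%:R / (2 * t)%:R) :> R)%R.
    by rewrite natrM; field; rewrite gt_eqF.
  apply: expR_le1D2x; first by rewrite divr_ge0// ler0n.
  rewrite natrM ler_pdivrMr; last by rewrite mulr_gt0.
  have : ((del a)%:R <= t%:R :> R)%R by rewrite ler_nat.
  lra.
apply: le_trans (ler_sum _ step) _.
rewrite -mulr_sumr -[leRHS]mulr_natr -mulrA ler_wpM2l ?expR_ge0//.
rewrite expRN ler_pdivrMl ?expR_gt0// big_split/= sumr_const -mulr_suml -natr_sum.
have le_delY : ((\sum_(a in A) del a)%:R <= Y%:R :> R)%R by rewrite ler_nat.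
have le_kA : (k%:R <= 2 * #|A|%:R :> R)%R by rewrite -natrM ler_nat.
(* Since [A] holds at least half of the colours, the average of [del a / t] over [A] is at most
   [al * Y], which the factor [expR (- (al * Y))] absorbs. *)
have tal : (1 / t%:R <= al * #|A|%:R)%R.
  rewrite /al natrM ler_pdivrMr//.
  have -> : (2 / (t%:R * k%:R) * #|A|%:R * t%:R = 2 * #|A|%:R / k%:R :> R)%R.
    by field; rewrite !gt_eqF.
  by rewrite ler_pdivlMr// mul1r.
have alY : (Y%:R / t%:R <= al * Y%:R * #|A|%:R)%R.
  rewrite -[X in (X / _)%R]mulr1 -mulrA mulrAC [leRHS]mulrC.
  by rewrite ler_wpM2l ?ler0n.
apply: le_trans (_ : ((1 + al * Y%:R) * #|A|%:R <= _)%R); last first.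
  by rewrite ler_wpM2r ?ler0n ?expR_ge1Dx.
rewrite mulrDl mul1r lerD2l; apply: le_trans alY.
by rewrite ler_pM2r ?invr_gt0.
Qed.

Let partial_coloring (S : {set T}) : exists (c : T -> 'I_k) (B : {set T}),
  [/\ {in S &, forall x y, x != y -> F x y -> c x != c y},
      {in S &, forall s e, s != e -> c s = c e -> forall w, K s w e -> w \in B} &
      (potential S B <= #|I|%:R)%R].
Proof.
move: {2}#|S| (erefl #|S|) => n; elim: n S => [|n IH] S cS.
  move/eqP: cS; rewrite cards_eq0 => /eqP ->.
  exists (fun=> Ordinal k_gt0), set0; split=> [x y|x y|]; rewrite ?inE//.
  rewrite /potential -sumr_const; apply: ler_sum => i _.
  by rewrite setI0 cards0 mul0r big_set0 mulr0 subr0 expR0.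
have S0 : S != set0 by rewrite -card_gt0 cS.
(* The vertex of low total conflict is coloured last, after the induction hypothesis has coloured
   the rest. *)
have [x xS xlow] : exists2 x, x \in S & \sum_(y in S)
    (#|[set w | K x w y]| + #|[set w | K y w x]|) <= 2 * M.
  apply: (exists_low_weight (f := fun s e => #|[set w | K s w e]|)) => // s _.
  apply: leq_trans (KM s).
  by rewrite big_mkcond; apply: leq_sum => e _; case: ifP.
have cS' : #|S :\ x| = n by move: cS; rewrite (cardsD1 x) xS; case.
have [c [B [cF cK pot]]] := IH _ cS'.
pose A := [set a | (#|promoted (S :\ x) c x a| <= t) &&
    [forall y in S :\ x, F x y ==> (c y != a)]].
have kA : k <= 2 * #|A|.
  apply: many_colors; apply: leq_trans xlow.
  by rewrite [leqRHS](big_setD1 x xS) leq_addl.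
have At : {in A, forall a, #|promoted (S :\ x) c x a| <= t}.
  by move=> a; rewrite inE => /andP[].
have [a aA pota] := potential_step xS kA At pot.
exists (fun y => if y == x then a else c y), (B :|: promoted (S :\ x) c x a).
move: aA; rewrite inE => /andP[_ /forall_inP aF].
split=> // y z yS zS.
- case: (eqVneq y x) (eqVneq z x) => [->|yx] [->|zx] yz Fyz; rewrite ?eqxx// in yz *.
  + by rewrite eq_sym (implyP (aF z _))// !inE zx.
  + by rewrite (implyP (aF y _)) 1?Fsym// !inE yx.
  + by apply: cF => //; rewrite !inE ?yx ?zx.
- case: (eqVneq y x) (eqVneq z x) => [->|yx] [->|zx] yz cyz w Kw; rewrite ?eqxx// in yz *.
  + rewrite !inE; apply/orP; right; apply/existsP; exists z.
    by rewrite !inE zx zS -cyz eqxx Kw.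
  + rewrite !inE; apply/orP; right; apply/existsP; exists y.
    by rewrite !inE yx yS cyz eqxx Kw orbT.
  + by rewrite inE (cK y z)// !inE ?yx ?zx.
Qed.

Lemma exists_coloring_promotion : exists (c : T -> 'I_k) (B : {set T}),
  [/\ forall x y, x != y -> F x y -> c x != c y,
      forall s e, s != e -> c s = c e -> forall w, K s w e -> w \in B &
      (\sum_i expR (#|W i :&: B|%:R / (2 * t)%:R - 2 / (t * k)%:R *
         (\sum_s \sum_e #|[set w in W i | K s w e]|)%:R) <= #|I|%:R :> R)%R].
Proof.
have [c [B [cF cK pot]]] := partial_coloring setT.
exists c, B; split=> [x y|s e|]; [exact: cF|exact: cK|].
apply: le_trans pot; rewrite le_eqVlt; apply/orP; left; apply/eqP.
apply: eq_bigr => i _; do 4?congr (_ _); congr (_%:R)%R.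
rewrite [RHS]big_mkcond/=; apply: eq_bigr => s _; rewrite inE.
by rewrite [RHS]big_mkcond/=; apply: eq_bigr => e _; rewrite inE.
Qed.

End Promotion.

(** * Assembling the ranking *)

Lemma vr_number_le (T : finType) (l : nat) (G : sgraph T) (k : nat) (phi : T -> nat) :
  (forall x, phi x < k) -> vertex_ranking l G (fun x => Posz (phi x).+1) ->
  vr_number l G <= k.
Proof.
move=> phik rk; rewrite /vr_number; case: ex_minnP => m _; apply; apply/asboolP.
by exists (fun x => Posz (phi x).+1) => // x; rewrite !lez_nat /=.
Qed.

Lemma sum_card_exchange (T : finType) (V : {set T}) (P : T -> T -> bool) :
  \sum_e #|[set w in V | P w e]| = \sum_(w in V) #|[set e | P w e]|.
Proof.
under eq_bigr do rewrite cardsE -sum1_card big_mkcond.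
rewrite exchange_big /= [RHS]big_mkcond; apply: eq_bigr => w _ /=.
case: ifPn => wV.
  by rewrite cardsE -sum1_card [RHS]big_mkcond; apply: eq_bigr => e _; rewrite unfold_in /= wV.
by apply: big1 => e _; rewrite unfold_in /= (negPf wV).
Qed.

Section Ranking.
Variables (R : realType) (T : finType) (G : sgraph T) (lay : T -> nat).
Variables (l j D Delta t : nat).
Hypotheses (Delta_gt0 : 0 < Delta) (t_gt0 : 0 < t) (Delta_le : Delta <= t ^ 2).
Hypothesis l_ge2 : 2 <= l.
Hypothesis lay_lt : forall x, lay x < j.
Hypothesis up_le : forall x, #|[set y | G x y & lay x <= lay y]| <= D.
Hypothesis deg_le : forall x, degree G x <= Delta.
Hypothesis T_gt0 : 0 < #|T|.

Let r := l./2.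
Let kappa := (D + 2) ^ l.
(** The 6 is the sum of the coefficients 2 and 4 in [k_large]; [Delta <= t ^ 2] turns the term in
    [Delta ^ r] into [Delta ^ r.-1 * t ^ 2]. *)
Let k := 6 * kappa ^ 2 * Delta ^ r.-1 * t.
Let reach_l := reach G lay l.
Let conflict (s w e : T) := [&& w \in reach_l 1 s, s \in reach_l 0 w & e \in reach_l r.-1 w].
Let level (x y : T) := (y \in reach_l 0 x) && (x \in reach_l 0 y).

Let kappa_gt0 : 0 < kappa. Proof. by rewrite expn_gt0 addn2. Qed.
Let P_gt0 : 0 < Delta ^ r.-1. Proof. by rewrite expn_gt0 Delta_gt0. Qed.
Let r_gt0 : 0 < r. Proof. by rewrite half_gt0. Qed.

Let reach_le (a : nat) (v : T) : #|reach_l a v| <= kappa * Delta ^ a.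
Proof. exact: card_reach. Qed.

(** From [s] there are at most [kappa * Delta] choices of [w], then at most [kappa * Delta ^ r.-1]
    choices of [e]. *)
Let conflict_le (s : T) :
  \sum_e #|[set w | conflict s w e]| <= kappa ^ 2 * Delta ^ r.
Proof.
rewrite (eq_bigr (fun e => #|[set w in reach_l 1 s |
    (s \in reach_l 0 w) && (e \in reach_l r.-1 w)]|)); last first.
  by move=> e _; apply: eq_card => w; rewrite !inE.
rewrite sum_card_exchange.
apply: leq_trans (_ : \sum_(w in reach_l 1 s) (kappa * Delta ^ r.-1) <= _).
  apply: leq_sum => w _; apply: leq_trans (reach_le r.-1 w).
  by apply/subset_leq_card/subsetP => e; rewrite inE => /andP[].
rewrite sum_nat_const -(prednK r_gt0) (expnS Delta) /=.
by apply: leq_trans (leq_mul (reach_le 1 s) (leqnn _)) _; rewrite expn1 mulnACA mulnn.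
Qed.

(** With [w] fixed, the clause [s \in reach_l 0 w] of [conflict] leaves only [kappa] choices of [s]:
    the level start of the walk is climbed back without descent. *)
Let conflict_through_le (V : {set T}) :
  \sum_s \sum_e #|[set w in V | conflict s w e]| <= #|V| * (kappa ^ 2 * Delta ^ r.-1).
Proof.
under eq_bigr do rewrite sum_card_exchange.
rewrite exchange_big /= -sum_nat_const; apply: leq_sum => w wV.
apply: leq_trans (_ : \sum_(s in reach_l 0 w) (kappa * Delta ^ r.-1) <= _).
  rewrite [leqRHS]big_mkcond; apply: leq_sum => s _; case: ifPn => sw.
    apply: leq_trans (reach_le r.-1 w); apply/subset_leq_card/subsetP => e.
    by rewrite inE => /and3P[].
  rewrite leqn0 cards_eq0; apply/eqP/setP => e.
  by rewrite !inE /conflict (negPf sw) /= andbF.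
rewrite sum_nat_const; apply: leq_trans (leq_mul (reach_le 0 w) (leqnn _)) _.
by rewrite expn0 muln1 mulnA mulnn.
Qed.

Let level_le (x : T) : #|[set y | level x y]| <= kappa.
Proof.
rewrite -[leqRHS]muln1 -(expn0 Delta); apply: leq_trans (reach_le 0 x).
by apply/subset_leq_card/subsetP => y; rewrite inE => /andP[].
Qed.

Lemma vr_number_le_layering : exists2 X : nat,
  (X%:R <= (2 * t)%:R * ln #|T|%:R + (kappa * Delta ^ r.-1 * t)%:R :> R)%R &
  vr_number l G <= j * k + (2 * X).+1.
Proof.
have k_gt0 : 0 < k by rewrite /k !muln_gt0 P_gt0 kappa_gt0 t_gt0.
have k_large : 2 * kappa * t + 4 * (kappa ^ 2 * Delta ^ r) <= k * t.
  rewrite /k -(prednK r_gt0) (expnS Delta) /=.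
  have : kappa ^ 2 * Delta ^ r.-1 * Delta <= kappa ^ 2 * Delta ^ r.-1 * t ^ 2.
    by rewrite leq_mul2l Delta_le orbT.
  have : kappa * t * 1 <= kappa * t * (kappa * Delta ^ r.-1 * t).
    by rewrite leq_mul2l !muln_gt0 kappa_gt0 P_gt0 t_gt0 orbT.
  by move: (Delta ^ r.-1) => P; rewrite !expnS expn0; nia.
have level_sym : symmetric level by move=> x y; rewrite /level andbC.
have [c [B [clevel cconf pot]]] :=
  @exists_coloring_promotion R T T conflict level (reach_l r) k t _ _
  t_gt0 k_gt0 conflict_le level_sym level_le k_large.
pose X := \max_u #|reach_l r u :&: B|.
have [|cB cBX cBP] := @exists_proper_coloring T (fun x y => y \in reach_l r x) X B.
  move=> x xB; apply: leq_trans (leq_bigmax x).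
  by apply/subset_leq_card/subsetP => y; rewrite !inE andbC.
exists X.
  have [u Xu] := bigop.eq_bigmax (fun u => #|reach_l r u :&: B|) T_gt0.
  set q := (\sum_s \sum_e #|[set w in reach_l r u | conflict s w e]|).
  have le_q : 4 * q <= kappa * Delta ^ r.-1 * t * k.
    have le_q : q <= kappa ^ 2 * Delta ^ r.-1 * (kappa * Delta ^ r.-1 * t ^ 2).
      apply: leq_trans (conflict_through_le _) _; rewrite mulnC leq_mul2l; apply/orP; right.
      apply: leq_trans (reach_le r u) _.
      rewrite -(prednK r_gt0) (expnS Delta) /= -mulnA leq_mul2l; apply/orP; right.
      by rewrite mulnC leq_mul2l Delta_le orbT.
    apply: leq_trans (leq_mul (leqnn 4) le_q) _.
    rewrite /k; move: (Delta ^ r.-1) kappa => P K; rewrite !expnS expn0; nia.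
  (* A single term of the potential is at most the whole sum, hence at most [#|T|]; take
     logarithms. *)
  have pot_u : (#|reach_l r u :&: B|%:R / (2 * t)%:R - 2 / (t * k)%:R * q%:R
      <= ln #|T|%:R :> R)%R.
    rewrite -ler_expR lnK ?posrE ?ltr0n//; apply: le_trans pot.
    by rewrite (bigD1 u)//= lerDl sumr_ge0// => i _; exact: expR_ge0.
  have t0 : (0 < t%:R :> R)%R by rewrite ltr0n.
  have k0 : (0 < k%:R :> R)%R by rewrite ltr0n.
  have qE : (2 / (t * k)%:R * q%:R = (4 * q)%:R / k%:R / (2 * t)%:R :> R)%R.
    rewrite (natrM _ t) (natrM _ 4) (natrM _ 2).
    by move: (k%:R)%R k0 => K K0; field; rewrite !gt_eqF.
  rewrite qE -mulrBl ler_pdivrMr ?ltr0n ?muln_gt0// lerBlDr in pot_u.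
  rewrite /X Xu; apply: le_trans pot_u _; rewrite mulrC lerD2l.
  by rewrite ler_pdivrMr// -natrM ler_nat.
(* Outside [B] a colour encodes layer and palette entry as quotient and remainder modulo [k]; [B]
   lies above all palettes. *)
pose phi x := if x \in B then j * k + cB x else lay x * k + c x.
have phi_notB x : x \notin B -> phi x < j * k.
  rewrite /phi => /negPf ->.
  apply: leq_trans (_ : (lay x).+1 * k <= _); last by rewrite leq_mul2r lay_lt orbT.
  by rewrite mulSn addnC ltn_add2r.
have phi_B x : x \in B -> j * k <= phi x by rewrite /phi => ->; rewrite leq_addr.
have phi_lay x : x \notin B -> phi x %/ k = lay x /\ phi x %% k = c x.
  rewrite /phi => /negPf ->; rewrite divnMDl// modnMDl divn_small ?ltn_ord// addn0.
  by rewrite modn_small.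
apply: (vr_number_le (phi := phi)) => [x|].
  rewrite /phi; case: (boolP (x \in B)) => xB; first by rewrite ltn_add2l.
  by move: (phi_notB x xB); rewrite /phi (negPf xB) => /leq_trans; apply; rewrite leq_addr.
apply: vertex_ranking_walks => x p pathp sizep lastx philast.
apply: contraT => /hasPn nlarge.
have le_phi z : z \in x :: p -> phi z <= phi x.
  by rewrite inE => /orP[/eqP->//|/nlarge]; rewrite -leqNgt.
have [q [pathq lastq sizeq subq downq]] := reverse_path lay pathp.
(* The two numbers of descents sum to at most [l], which is less than [2 * (r + 1)]. *)
have downr : downs lay x p <= r \/ downs lay (last x p) q <= r.
  have := leq_trans downq sizep; rewrite -(odd_double_half l) -/r.
  by case: (odd l); rewrite -mul2n /=; lia.
(* If [x] is in [B], so is the other end, and one end reaches the other with at most [r] descents;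
   [cB] separates them. *)
case: (boolP (x \in B)) => xB.
  have yB : last x p \in B.
    by apply: contraT => /phi_notB; rewrite philast ltnNge phi_B.
  have cBE : cB x = cB (last x p).
    by apply/esym/eqP; move: philast; rewrite /phi xB yB => /addnI ->.
  case: downr => down.
    have : cB x != cB (last x p).
      apply: cBP; rewrite // 1?eq_sym//.
      exact: (reach_mono sizep down (reach_path lay pathp)).
    by rewrite cBE eqxx.
  have : cB (last x p) != cB x.
    apply: cBP => //; rewrite -{1}lastq.
    apply: (reach_mono _ down (reach_path lay pathq)); by rewrite sizeq.
  by rewrite cBE eqxx.
(* Otherwise the walk avoids [B] and never rises above the layer of [x]: both would give a larger
   colour. It is then level, excluded by [clevel], or its first descent lies in [B] by [cconf]. *)
have notB z : z \in x :: p -> z \notin B.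
  move=> /le_phi le_zx; apply: contraL (phi_notB x xB) => /phi_B le_jz.
  by rewrite -leqNgt (leq_trans le_jz).
have le_lay z : z \in x :: p -> lay z <= lay x.
  move=> zp; have [<- _] := phi_lay z (notB z zp); have [<- _] := phi_lay x xB.
  by rewrite leq_div2r// le_phi.
have yB : last x p \notin B by apply: notB; exact: mem_last.
have [layE cE] : lay (last x p) = lay x /\ c (last x p) = c x.
  have [<- cy] := phi_lay _ yB; have [<- cx] := phi_lay _ xB.
  by rewrite philast; split=> //; apply: val_inj; rewrite /= -cy -cx philast.
case: downr => down.
  have [|[l1 l2]|[w wp [w1 w2 w3]]] := first_descent pathp sizep down.
  - by move=> z zp; apply: le_lay; rewrite inE zp orbT.
  - have : c x != c (last x p) by rewrite clevel 1?eq_sym// /level l1 l2.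
    by rewrite cE eqxx.
  - have := notB w; rewrite inE wp orbT => /(_ isT).
    rewrite (cconf x (last x p)) ?cE// 1?eq_sym//.
    by rewrite /conflict w1 w2 w3.
rewrite -sizeq in sizep.
have [|[l1 l2]|[w wq [w1 w2 w3]]] := first_descent pathq sizep down.
- by move=> z /subq zp; rewrite layE le_lay.
- have : c (last x p) != c x.
    by rewrite clevel// /level; rewrite lastq in l1 l2; rewrite l1 l2.
  by rewrite cE eqxx.
- have := notB w (subq w wq); rewrite (cconf (last x p) x) ?cE//.
  by rewrite /conflict w1 w2; rewrite lastq in w3.
Qed.

End Ranking.

(** * Logarithms, square roots and the final bounds *)

Lemma exists_nat_sqrt (n : nat) : 0 < n -> exists t, [/\ 0 < t, n <= t ^ 2 & t ^ 2 <= 4 * n].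
Proof.
move=> n0; have ex : exists t, n <= t ^ 2 by exists n; nia.
case: (ex_minnP ex) => t le_nt tmin; exists t.
have t0 : 0 < t by case: t le_nt {tmin} => //; lia.
(* Minimality of [t] gives [t.-1 ^ 2 < n], and [t <= 2 * t.-1] unless [t] is 1. *)
split=> //; have : ~~ (n <= t.-1 ^ 2) by apply/negP => /tmin; lia.
rewrite -ltnNge -{2}(prednK t0); move: t.-1 => [|s]; nia.
Qed.

Lemma ln_ge_half (R : realType) (x : R) : (2 <= x -> 1 / 2 <= ln x)%R.
Proof.
move=> x2; have x0 : (0 < x)%R by lra.
rewrite -ler_expR lnK ?posrE//; apply: le_trans x2.
have := @expR_le1D2x R (1 / 2); lra.
Qed.

Lemma trunc_log2_le (R : realType) (n : nat) : 0 < n ->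
  ((trunc_log 2 n)%:R <= 2 * ln n%:R :> R)%R.
Proof.
move=> n0; have := @ln_ge_half R 2 (lexx _).
have : (ln (2 ^ trunc_log 2 n)%:R <= ln n%:R :> R)%R.
  by rewrite ler_ln ?posrE ?ltr0n ?expn_gt0// ler_nat trunc_logP.
rewrite natrX lnXn// -mulr_natr => le1 le2.
have : (0 <= (trunc_log 2 n)%:R :> R)%R by rewrite ler0n.
nra.
Qed.

Local Open Scope ring_scope.

Lemma vr_number_le_log (R : realType) (d l : nat) : (2 <= l)%N -> exists2 c : R, 0 <= c &
  forall Delta : nat, (0 < Delta)%N ->
  forall (T : finType) (G : sgraph T), (2 <= #|T|)%N -> degenerate d G ->
    (max_degree G <= Delta)%N ->
    (vr_number l G)%:R <= c * Delta%:R `^ ((l./2)%:R - 1 / 2) * ln #|T|%:R.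
Proof.
move=> l2; pose kappa := ((4 * d + 2) ^ l)%N.
(* The outer 2 comes from [t <= 2 * sqrt Delta]. Inside, [24 * kappa ^ 2] pays for the palettes,
   [4 * kappa] and 4 for [2 * X], and the remaining 2 for the final [+ 1]. *)
exists (2 * (24 * kappa ^ 2 + 4 * kappa + 6)%:R); first by rewrite mulr_ge0 ?ler0n.
move=> Delta Delta0 T G T2 degG maxG.
have T0 : (0 < #|T|)%N by lia.
have [t [t0 le_Dt le_tD]] := exists_nat_sqrt Delta0.
have [lay layj layd] := exists_layering degG (trunc_log_ltn #|T| (isT : 1 < 2)%N).
have deg x : (degree G x <= Delta)%N.
  by apply: leq_trans maxG; rewrite /max_degree (bigD1 x)//= leq_maxl.
have [X leX levr] := vr_number_le_layering R Delta0 t0 le_Dt l2 layj layd deg T0.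
have L0 : 1 / 2 <= ln #|T|%:R :> R by apply: ln_ge_half; rewrite (ler_nat R 2).
have logL := trunc_log2_le R T0.
set L : R := ln _ in L0 logL leX *; rewrite -/kappa in leX levr.
have r0 : (0 < l./2)%N by rewrite half_gt0.
pose P := (Delta ^ (l./2).-1)%N; rewrite -/P in leX levr.
have PE : P%:R * t%:R <= 2 * Delta%:R `^ ((l./2)%:R - 1 / 2) :> R.
  have D0 : (Delta%:R != 0 :> R) by rewrite pnatr_eq0 -lt0n.
  have -> : (l./2)%:R - 1 / 2 = ((l./2).-1)%:R + 2^-1 :> R.
    by rewrite -{1}(prednK r0) -natr1; field.
  rewrite powRD ?D0 ?implybT// powR_mulrn ?ler0n// powR12_sqrt ?ler0n// -natrX -/P.
  rewrite mulrCA ler_wpM2l ?ler0n//.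
  rewrite -ler_sqr ?nnegrE ?mulr_ge0 ?ler0n ?sqrtr_ge0// exprMn sqr_sqrtr ?ler0n//.
  by rewrite -!natrX -natrM ler_nat.
have P0 : (0 < P)%N by rewrite expn_gt0 Delta0.
pose Q : R := P%:R * t%:R.
have Q1 : 1 <= Q by rewrite /Q -natrM (ler_nat R 1) muln_gt0 P0.
have tQ : t%:R <= Q by rewrite /Q ler_peMl ?ler0n// (ler_nat R 1).
have K0 : 0 <= kappa%:R :> R by rewrite ler0n.
have natrE (a b e : nat) :
    (a.+1 * b + (2 * e).+1)%:R = (a%:R + 1) * b%:R + (2 * e%:R + 1) :> R.
  by rewrite natrD natrM -(natr1 a) -(natr1 (2 * e)) natrM.
have kE : (6 * kappa ^ 2 * P * t)%:R = 6 * kappa%:R ^+ 2 * Q :> R.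
  by rewrite /Q (natrM _ _ t) (natrM _ _ P) (natrM _ 6) natrX mulrA.
move: levr; rewrite -(ler_nat R) natrE kE => levr.
have {}leX : X%:R <= 2 * t%:R * L + kappa%:R * Q.
  by move: leX; rewrite (natrM _ 2) (natrM _ (kappa * P)) (natrM _ kappa) -(mulrA kappa%:R).
apply: le_trans levr _.
have -> : (24 * kappa ^ 2 + 4 * kappa + 6)%:R = 24 * kappa%:R ^+ 2 + 4 * kappa%:R + 6 :> R.
  by rewrite (natrD _ _ 6) (natrD _ (24 * kappa ^ 2)) (natrM _ 24) (natrM _ 4) natrX.
set E := _ `^ _ in PE *; rewrite -/Q in PE.
move: (kappa%:R) K0 leX => K K0 leX.
apply: le_trans (_ : Q * L * (24 * K ^+ 2 + 4 * K + 6) <= _); last first.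
  have -> : 2 * (24 * K ^+ 2 + 4 * K + 6) * E * L = 2 * E * L * (24 * K ^+ 2 + 4 * K + 6) by ring.
  by rewrite ler_wpM2r ?ler_wpM2r//; nra.
have leQL : 1 / 2 <= Q * L by nra.
(* The number of layers is at most [2 * L + 1], hence at most [4 * L] because [1 / 2 <= L]. *)
have le1 : ((trunc_log 2 #|T|)%:R + 1) * (6 * K ^+ 2 * Q) <= 4 * L * (6 * K ^+ 2 * Q).
  by rewrite ler_wpM2r//; [rewrite mulr_ge0 ?mulr_ge0 ?exprn_ge0//; lra | lra].
have le2 : t%:R * L <= Q * L by rewrite ler_wpM2r//; lra.
have le3 : K * Q <= 2 * (K * Q * L).
  by rewrite [leRHS]mulrCA ler_peMr ?mulr_ge0//; lra.
nra.
Qed.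

Theorem theorem3 (R : realType) (d l : nat) (hd : (0 < d)%N) (hl : (2 <= l)%N) :
  exists c : R,
  forall Delta n : nat, (d <= Delta)%N -> (Delta <= n)%N -> (2 <= n)%N ->
  forall (T : finType) (G : sgraph T),
    #|T| = n -> degenerate d G -> (max_degree G <= Delta)%N ->
    [/\ (vr_number l G)%:R
          <= c * Delta%:R `^ ((l./2)%:R - 1 / 2) * (ln n%:R) `^ (5 / 4),
        c * Delta%:R `^ ((l./2)%:R - 1 / 2) * (ln n%:R) `^ (5 / 4)
          = (if odd l then
               c * Delta%:R `^ (l%:R / 2 - 1) * (ln n%:R) `^ (5 / 4)
             else
               c * Delta%:R `^ (l%:R / 2 - 1 / 2) * (ln n%:R) `^ (5 / 4))
      & ln n%:R <= Delta%:R ^+ (l./2 - 1) :> R ->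
        (vr_number l G)%:R
          <= c * Delta%:R `^ ((l./2)%:R - 1 / 2) * ln n%:R].
Proof.
have [c c0 cP] := vr_number_le_log R d hl.
(* The factor 2 covers small [n]: as [ln n] is at least [1 / 2], its fourth root is too, so [ln n]
   is at most twice its power [5 / 4]. *)
exists (2 * c) => Delta n dD Dn n2 T G Tn degG maxG.
have Delta0 : (0 < Delta)%N by exact: leq_trans hd dD.
have le_vr := cP Delta Delta0 T G _ degG maxG; rewrite Tn in le_vr.
have {}le_vr := le_vr n2.
have L0 : 1 / 2 <= ln n%:R :> R by apply: ln_ge_half; rewrite (ler_nat R 2).
set L : R := ln _ in L0 le_vr *; set E : R := _ `^ (_ - 1 / 2) in le_vr *.
have E0 : 0 <= E by exact: powR_ge0.
have cE0 : 0 <= c * E by rewrite mulr_ge0.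
have L54 : L <= 2 * L `^ (5 / 4).
  have -> : 5 / 4 = 1 + 4^-1 :> R by field.
  have Lneq0 : L != 0 by rewrite gt_eqF//; lra.
  rewrite powRD ?Lneq0 ?implybT// powRr1; last by lra.
  rewrite mulrCA ler_peMr//; first by lra.
  have : (1 / 2) `^ 4^-1 <= L `^ 4^-1 by rewrite ge0_ler_powR ?nnegrE//; lra.
  have : (1 / 2 : R) `^ 1 <= (1 / 2) `^ 4^-1 by rewrite ger_powR//; lra.
  by rewrite powRr1; lra.
split.
- apply: le_trans le_vr _.
  have -> : 2 * c * E * L `^ (5 / 4) = c * E * (2 * L `^ (5 / 4)) by ring.
  by rewrite ler_wpM2l.
- have lE : l%:R = (odd l)%:R + (l./2)%:R * 2 :> R.
    by rewrite -natrM -natrD muln2 odd_double_half.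
  by rewrite /E lE; case: (odd l) => /=; congr (_ * powR _ _ * _); field.
- move=> _; apply: le_trans le_vr _.
  have -> : 2 * c * E * L = c * E * L + c * E * L by ring.
  by rewrite lerDl mulr_ge0//; lra.
Qed.
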